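(* Let $\mathbb{X}$ be a Cartesian differential abstract coKleisli category with differential combinator $\mathsf{D}$ and abstract coKleisli structure $(!, \varphi, \epsilon)$. Then $\epsilon\text{-}\mathsf{nat}[\mathbb{X}]$ is a category with finite biproducts and $(!, \beta, \epsilon, \partial)$ is a Cartesian differential comonad on $\epsilon\text{-}\mathsf{nat}[\mathbb{X}]$, where $\beta_A := !(\varphi_A) : !(A) \to !!(A)$ and the differential combinator transformation $\partial_A : !(A \times A) \to !(A)$ is defined by $$\partial_A := \epsilon_{!(A)} \circ !(\mathsf{D}[\varphi_A]).$$ Furthermore, the functor $\mathsf{G}_\epsilon : \mathbb{X} \to \epsilon\text{-}\mathsf{nat}[\mathbb{X}]_!$ defined by $\mathsf{G}_\epsilon(A)=A$ and $[\![\mathsf{G}_\epsilon(f)]\!]=\epsilon_B\circ !(f)$ for $f:A\to B$ is a Cartesian differential isomorphism, so in particular, with inverse $\mathsf{G}_\epsilon^{-1}$ given by $\mathsf{G}_\epsilon^{-1}(A)=A$ and $\mathsf{G}_\epsilon^{-1}([\![f]\!])=[\![f]\!]\circ\varphi_A$, the following equalities hold: $$[\![ \mathsf{G}_\epsilon(\mathsf{D}[f]) ]\!] = [\![ \mathsf{D}[\mathsf{G}_\epsilon(f)] ]\!], \qquad \mathsf{G}_\epsilon^{-1}([\![ \mathsf{D}[f] ]\!]) = \mathsf{D}[\mathsf{G}_\epsilon^{-1}([\![ f ]\!])],$$ where the differential combinator on the coKleisli category $\epsilon\text{-}\mathsf{nat}[\mathbb{X}]_!$ is the one induced by $\partial$,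 i.e. $[\![\mathsf{D}[f]]\!]=[\![f]\!]\circ\partial_A$.
   Context: Composition is in classical order: $g \circ f$ means first $f$, then $g$. In a category with (chosen) finite products, $\pi_0,\pi_1$ are the projections of $A\times B$, $\langle f,g\rangle$ is pairing, $h\times k=\langle h\circ\pi_0,k\circ\pi_1\rangle$, and $\top$ is the terminal object. Cartesian left additive categories. A left additive category is a category whose hom-sets are commutative monoids (with $+$ and $0$) such that $(f+g)\circ x=f\circ x+g\circ x$ and $0\circ x=0$. A map $f$ is additive if $f\circ(x+y)=f\circ x+f\circ y$ and $f\circ 0=0$. A Cartesian left additive category is a left additive category with finite products in which all projections are additive. A category with finite biproducts is the same as a Cartesian left additive category in which every map is additive. In a Cartesian left additive category define $\iota_0=\langle 1_A,0\rangle: A\to A\times B$, $\iota_1=\langle 0,1_B\rangle: B\to A\times B$, $\nabla_A=\pi_0+\pi_1: A\times A\to A$, $\ell_A=\iota_0\times\iota_1: A\times A\to (A\times A)\times(A\times A)$, $c_A=\langle\pi_0\times\pi_0,\pi_1\times\pi_1\rangle:(A\times A)\times(A\times A)\to(A\times A)\times(A\times A)$. Cartesian differential categories. A differential combinator on a Cartesian left additive category is a family of operators sending $f:A\to B$ to $\mathsf{D}[f]:A\times A\to B$ with: [CD.1] $\mathsf{D}[f+g]=\mathsf{D}[f]+\mathsf{D}[g]$, $\mathsf{D}[0]=0$; [CD.2] $\mathsf{D}[f]\circ(1_A\times\nabla_A)=\mathsf{D}[f]\circ(1_A\times\pi_0)+\mathsf{D}[f]\circ(1_A\times\pi_1)$,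 $\mathsf{D}[f]\circ\iota_0=0$; [CD.3] $\mathsf{D}[1_A]=\pi_1$, $\mathsf{D}[\pi_0]=\pi_0\circ\pi_1$, $\mathsf{D}[\pi_1]=\pi_1\circ\pi_1$; [CD.4] $\mathsf{D}[\langle f,g\rangle]=\langle\mathsf{D}[f],\mathsf{D}[g]\rangle$; [CD.5] $\mathsf{D}[g\circ f]=\mathsf{D}[g]\circ\langle f\circ\pi_0,\mathsf{D}[f]\rangle$; [CD.6] $\mathsf{D}[\mathsf{D}[f]]\circ\ell_A=\mathsf{D}[f]$; [CD.7] $\mathsf{D}[\mathsf{D}[f]]\circ c_A=\mathsf{D}[\mathsf{D}[f]]$. A Cartesian differential category is a Cartesian left additive category with a differential combinator. A map $f$ is $\mathsf{D}$-linear if $\mathsf{D}[f]=f\circ\pi_1$. A Cartesian differential isomorphism is an isomorphism of categories which strictly preserves the finite product structure, the additive structure, and the differential combinator. Abstract coKleisli categories. An abstract coKleisli structure on a category $\mathbb{X}$ is a triple $(!,\varphi,\epsilon)$ with an endofunctor $!:\mathbb{X}\to\mathbb{X}$, a natural transformation $\varphi_A:A\to !(A)$, and a family of maps $\epsilon_A:!(A)\to A$ (not necessarily natural) such that $\epsilon_{!(A)}:!!(A)\to !(A)$ is natural in $A$ and $\epsilon_A\circ\varphi_A=1_A$, $\epsilon_{!(A)}\circ !(\varphi_A)=1_{!(A)}$, $\epsilon_A\circ\epsilon_{!(A)}=\epsilon_A\circ !(\epsilon_A)$. A map $f:A\to B$ is $\epsilon$-natural if $\epsilon_B\circ !(f)=f\circ\epsilon_A$;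 $\epsilon\text{-}\mathsf{nat}[\mathbb{X}]$ is the subcategory with the same objects and the $\epsilon$-natural maps. (It is known that $\epsilon_A$ and $!(f)$ are always $\epsilon$-natural, that $(!,\beta,\epsilon)$ is a comonad on $\epsilon\text{-}\mathsf{nat}[\mathbb{X}]$, and that $\mathsf{G}_\epsilon$ is an isomorphism of categories with the indicated inverse.) A Cartesian left additive abstract coKleisli category is a Cartesian left additive category with an abstract coKleisli structure such that all projections $\pi_0,\pi_1$ are $\epsilon$-natural, zero maps are $\epsilon$-natural, and the sum of two parallel $\epsilon$-natural maps is $\epsilon$-natural. A Cartesian differential abstract coKleisli category is a Cartesian left additive abstract coKleisli category which is also a Cartesian differential category and in which every $\epsilon$-natural map is $\mathsf{D}$-linear. coKleisli categories. For a comonad $(!,\delta,\varepsilon)$ on $\mathbb{Y}$, the coKleisli category $\mathbb{Y}_!$ has the objects of $\mathbb{Y}$, and a map $f:A\to B$ in $\mathbb{Y}_!$ is a map $[\![f]\!]:!(A)\to B$ in $\mathbb{Y}$; $[\![g\circ f]\!]=[\![g]\!]\circ !([\![f]\!])\circ\delta_A$, $[\![1_A]\!]=\varepsilon_A$. If $\mathbb{Y}$ is Cartesian left additive, so is $\mathbb{Y}_!$: products on objects and $\top$ as in $\mathbb{Y}$, $[\![\pi_j]\!]=\pi_j\circ\varepsilon_{A\times B}$, $[\![\langle f,g\rangle]\!]=\langle[\![f]\!],[\![g]\!]\rangle$, $[\![f+g]\!]=[\![f]\!]+[\![g]\!]$, $[\![0]\!]=0$. Cartesian differential comonads. For a comonad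 $(!,\delta,\varepsilon)$ on a category with finite biproducts, a differential combinator transformation is a natural transformation $\partial_A:!(A\times A)\to !(A)$ with: [dc.1] $\partial_A\circ !(\iota_0)=0$; [dc.2] $\partial_A\circ !(1_A\times\nabla_A)=\partial_A\circ(!(1_A\times\pi_0)+!(1_A\times\pi_1))$; [dc.3] $\varepsilon_A\circ\partial_A=\pi_1\circ\varepsilon_{A\times A}$; [dc.4] $\delta_A\circ\partial_A=\partial_{!(A)}\circ !(\langle !(\pi_0),\partial_A\rangle)\circ\delta_{A\times A}$; [dc.5] $\partial_A\circ\partial_{A\times A}\circ !(\ell_A)=\partial_A$; [dc.6] $\partial_A\circ\partial_{A\times A}\circ !(c_A)=\partial_A\circ\partial_{A\times A}$. A Cartesian differential comonad is a quadruple $(!,\delta,\varepsilon,\partial)$ of a comonad on a category with finite biproducts and a differential combinator transformation; its coKleisli category is then a Cartesian differential category with $[\![\mathsf{D}[f]]\!]=[\![f]\!]\circ\partial_A$. *)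

(* Defs.v *)
From Stdlib Require Import ssreflect ProofIrrelevance.

Set Implicit Arguments.
Unset Strict Implicit.
Unset Printing Implicit Defensive.

Declare Scope cat_scope.
Delimit Scope cat_scope with cat.
Open Scope cat_scope.

Record Category := {
  Ob :> Type;
  Hom : Ob -> Ob -> Type;
  idm : forall A, Hom A A;
  comp : forall A B C, Hom B C -> Hom A B -> Hom A C;
  comp1m : forall A B (f : Hom A B), comp (idm B) f = f;
  compm1 : forall A B (f : Hom A B), comp f (idm A) = f;
  compA : forall A B C E (h : Hom C E) (g : Hom B C) (f : Hom A B),
    comp h (comp g f) = comp (comp h g) f
}.
Arguments Hom {c} A B.
Arguments idm {c} A.
Arguments comp {c A B C} g f.

(* Classical order: [g ∘ f] is first [f], then [g]. *)
Notation "g ∘ f" := (comp g f) (at level 40, left associativity) : cat_scope.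

Record Functor (X Y : Category) := {
  fobj :> X -> Y;
  fmap : forall A B : X, Hom A B -> Hom (fobj A) (fobj B);
  fmap_id : forall A : X, fmap (idm A) = idm (fobj A);
  fmap_comp : forall (A B C : X) (g : Hom B C) (f : Hom A B),
    fmap (g ∘ f) = fmap g ∘ fmap f
}.
Arguments fmap {X Y} F {A B} f : rename.

Definition functor_id (X : Category) : Functor X X :=
  {| fobj := fun A => A;
     fmap := fun A B f => f;
     fmap_id := fun A => eq_refl;
     fmap_comp := fun A B C g f => eq_refl |}.

Section FunctorComp.
Variables (X Y Z : Category) (G : Functor Y Z) (F : Functor X Y).

Lemma functor_comp_id (A : X) : fmap G (fmap F (idm A)) = idm (G (F A)).
Proof. by rewrite !fmap_id. Qed.

Lemma functor_comp_comp (A B C : X) (g : Hom B C) (f : Hom A B) :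
  fmap G (fmap F (g ∘ f)) = fmap G (fmap F g) ∘ fmap G (fmap F f).
Proof. by rewrite !fmap_comp. Qed.

Definition functor_comp : Functor X Z :=
  {| fobj := fun A => G (F A);
     fmap := fun A B f => fmap G (fmap F f);
     fmap_id := functor_comp_id;
     fmap_comp := functor_comp_comp |}.
End FunctorComp.

Definition inverse_functors (X Y : Category)
    (F : Functor X Y) (G : Functor Y X) : Prop :=
  functor_comp G F = functor_id X /\ functor_comp F G = functor_id Y.

Record Comonad (Y : Category) := {
  cm_fun :> Functor Y Y;
  delta : forall A : Y, Hom (cm_fun A) (cm_fun (cm_fun A));
  counit : forall A : Y, Hom (cm_fun A) A;
  delta_nat : forall (A B : Y) (f : Hom A B),
    delta B ∘ fmap cm_fun f = fmap cm_fun (fmap cm_fun f) ∘ delta A;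
  counit_nat : forall (A B : Y) (f : Hom A B),
    counit B ∘ fmap cm_fun f = f ∘ counit A;
  counit_delta : forall A : Y, counit (cm_fun A) ∘ delta A = idm (cm_fun A);
  fmap_counit_delta : forall A : Y,
    fmap cm_fun (counit A) ∘ delta A = idm (cm_fun A);
  delta_delta : forall A : Y,
    delta (cm_fun A) ∘ delta A = fmap cm_fun (delta A) ∘ delta A
}.
Arguments delta {Y} c A.
Arguments counit {Y} c A.

Record FiniteProducts (X : Category) := {
  fp_top : X;
  fp_bang : forall A : X, Hom A fp_top;
  fp_bang_uniq : forall (A : X) (f g : Hom A fp_top), f = g;
  fp_prod : X -> X -> X;
  fp_pi0 : forall A B : X, Hom (fp_prod A B) A;
  fp_pi1 : forall A B : X, Hom (fp_prod A B) B;
  fp_pair : forall A B C : X, Hom C A -> Hom C B -> Hom C (fp_prod A B);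
  fp_pi0_pair : forall (A B C : X) (f : Hom C A) (g : Hom C B),
    fp_pi0 A B ∘ fp_pair f g = f;
  fp_pi1_pair : forall (A B C : X) (f : Hom C A) (g : Hom C B),
    fp_pi1 A B ∘ fp_pair f g = g;
  fp_pair_uniq : forall (A B C : X) (h : Hom C (fp_prod A B)),
    h = fp_pair (fp_pi0 A B ∘ h) (fp_pi1 A B ∘ h)
}.

Record LeftAdditive (X : Category) := {
  la_add : forall A B : X, Hom A B -> Hom A B -> Hom A B;
  la_zero : forall A B : X, Hom A B;
  la_addA : forall (A B : X) (f g h : Hom A B),
    la_add f (la_add g h) = la_add (la_add f g) h;
  la_addC : forall (A B : X) (f g : Hom A B), la_add f g = la_add g f;
  la_add0 : forall (A B : X) (f : Hom A B), la_add (la_zero A B) f = f;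
  la_comp_add : forall (A B C : X) (f g : Hom B C) (x : Hom A B),
    la_add f g ∘ x = la_add (f ∘ x) (g ∘ x);
  la_comp_zero : forall (A B C : X) (x : Hom A B),
    la_zero B C ∘ x = la_zero A C
}.

Definition additive_for (X : Category) (L : LeftAdditive X) (A B : X)
    (f : Hom A B) : Prop :=
  (forall (C : X) (x y : Hom C A),
     f ∘ la_add L x y = la_add L (f ∘ x) (f ∘ y)) /\
  (forall C : X, f ∘ la_zero L C A = la_zero L C B).

Record CLACat := {
  cla_cat :> Category;
  cla_prod : FiniteProducts cla_cat;
  cla_add : LeftAdditive cla_cat;
  cla_pi0_additive : forall A B, additive_for cla_add (fp_pi0 cla_prod A B);
  cla_pi1_additive : forall A B, additive_for cla_add (fp_pi1 cla_prod A B)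
}.

Section CLAOperations.
Context {X : CLACat}.
Definition top : X := fp_top (cla_prod X).
Definition prd (A B : X) : X := fp_prod (cla_prod X) A B.
Definition pi0 (A B : X) : Hom (prd A B) A := fp_pi0 (cla_prod X) A B.
Definition pi1 (A B : X) : Hom (prd A B) B := fp_pi1 (cla_prod X) A B.
Definition pair {A B C : X} (f : Hom C A) (g : Hom C B) : Hom C (prd A B) :=
  fp_pair (cla_prod X) f g.
Definition add {A B : X} (f g : Hom A B) : Hom A B := la_add (cla_add X) f g.
Definition zero (A B : X) : Hom A B := la_zero (cla_add X) A B.
Definition additive {A B : X} (f : Hom A B) : Prop :=
  additive_for (cla_add X) f.
End CLAOperations.
Arguments top : clear implicits.
Arguments pi0 {X A B}.
Arguments pi1 {X A B}.
Arguments zero {X A B}.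

Notation "A × B" := (prd A B) (at level 40, left associativity) : cat_scope.
Notation "⟨ f , g ⟩" := (pair f g) (at level 0) : cat_scope.
Notation "f + g" := (add f g) : cat_scope.
Notation "0" := zero : cat_scope.

Section CLADerived.
Context {X : CLACat}.
Definition prod_map {A B C E : X} (h : Hom A C) (k : Hom B E) :
  Hom (A × B) (C × E) := ⟨h ∘ pi0, k ∘ pi1⟩.
Definition iota0 {A B : X} : Hom A (A × B) := ⟨idm A, 0⟩.
Definition iota1 {A B : X} : Hom B (A × B) := ⟨0, idm B⟩.
Definition nabla (A : X) : Hom (A × A) A := pi0 + pi1.
Definition ell (A : X) : Hom (A × A) ((A × A) × (A × A)) :=
  prod_map iota0 iota1.
Definition cflip (A : X) :
  Hom ((A × A) × (A × A)) ((A × A) × (A × A)) :=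
  ⟨prod_map pi0 pi0, prod_map pi1 pi1⟩.
End CLADerived.
Notation "h ⊠ k" := (prod_map h k) (at level 40, left associativity) : cat_scope.

Section CLATheory.
Context {X : CLACat}.
Implicit Types A B C E : X.

Lemma pi0_pair A B C (f : Hom C A) (g : Hom C B) : pi0 ∘ ⟨f, g⟩ = f.
Proof. exact: fp_pi0_pair. Qed.

Lemma pi1_pair A B C (f : Hom C A) (g : Hom C B) : pi1 ∘ ⟨f, g⟩ = g.
Proof. exact: fp_pi1_pair. Qed.

Lemma pair_ext A B C (h k : Hom C (A × B)) :
  pi0 ∘ h = pi0 ∘ k -> pi1 ∘ h = pi1 ∘ k -> h = k.
Proof.
move=> e0 e1.
have -> : h = ⟨pi0 ∘ h, pi1 ∘ h⟩ by exact: fp_pair_uniq.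
rewrite e0 e1; symmetry; exact: fp_pair_uniq.
Qed.

Lemma pair_comp A B C E (f : Hom C A) (g : Hom C B) (h : Hom E C) :
  ⟨f, g⟩ ∘ h = ⟨f ∘ h, g ∘ h⟩.
Proof. by apply: pair_ext; rewrite compA ?pi0_pair ?pi1_pair. Qed.

Lemma prod_map_pair A B C E F (h : Hom A C) (k : Hom B E)
    (f : Hom F A) (g : Hom F B) : (h ⊠ k) ∘ ⟨f, g⟩ = ⟨h ∘ f, k ∘ g⟩.
Proof. by rewrite /prod_map pair_comp -!compA pi0_pair pi1_pair. Qed.

Lemma addA A B (f g h : Hom A B) : f + (g + h) = (f + g) + h.
Proof. exact: la_addA. Qed.
Lemma addC A B (f g : Hom A B) : f + g = g + f.
Proof. exact: la_addC. Qed.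
Lemma add0 A B (f : Hom A B) : 0 + f = f.
Proof. exact: la_add0. Qed.
Lemma addf0 A B (f : Hom A B) : f + 0 = f.
Proof. by rewrite addC add0. Qed.
Lemma comp_add A B C (f g : Hom B C) (x : Hom A B) :
  (f + g) ∘ x = f ∘ x + g ∘ x.
Proof. exact: la_comp_add. Qed.
Lemma comp_zero A B C (x : Hom A B) : (0 : Hom B C) ∘ x = 0.
Proof. exact: la_comp_zero. Qed.
Lemma additive_add A B C (f : Hom A B) (x y : Hom C A) :
  additive f -> f ∘ (x + y) = f ∘ x + f ∘ y.
Proof. by case=> fD _; exact: fD. Qed.
Lemma additive_zero A B C (f : Hom A B) :
  additive f -> f ∘ (0 : Hom C A) = 0.
Proof. by case=> _ f0; exact: f0. Qed.
Lemma pi0_additive A B : additive (@pi0 X A B).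
Proof. exact: cla_pi0_additive. Qed.
Lemma pi1_additive A B : additive (@pi1 X A B).
Proof. exact: cla_pi1_additive. Qed.
Lemma top_uniq A (f g : Hom A (top X)) : f = g.
Proof. exact: fp_bang_uniq. Qed.
End CLATheory.

Definition has_finite_biproducts (X : CLACat) : Prop :=
  forall (A B : X) (f : Hom A B), additive f.

(* Agreement with the definition of biproducts as objects that are at once
   products and coproducts. *)
Lemma has_finite_biproductsE (X : CLACat) :
  has_finite_biproducts X <->
    (forall (B : X) (f g : Hom (top X) B), f = g) /\
    (forall (A B C : X) (f : Hom A C) (g : Hom B C),
       exists! h : Hom (A × B) C, h ∘ iota0 = f /\ h ∘ iota1 = g).
Proof.
split=> [bip|[ini cop] A B f].
- split=> [B f g|A B C f g].
    rewrite -(compm1 f) -(compm1 g) (top_uniq (idm _) 0).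
    by rewrite !additive_zero //; exact (bip _ _ _).
  exists (f ∘ pi0 + g ∘ pi1); split.
    rewrite !comp_add -!compA !pi0_pair !pi1_pair !compm1.
    by rewrite !additive_zero ?add0 ?addf0 //; exact (bip _ _ _).
  move=> h [<- <-]; rewrite -!compA -additive_add; first exact (bip _ _ _).
  suff -> : iota0 ∘ pi0 + iota1 ∘ pi1 = idm (A × B) by rewrite compm1.
  have p0 := @pi0_additive X A B; have p1 := @pi1_additive X A B.
  apply: pair_ext; rewrite additive_add // !compA ?pi0_pair ?pi1_pair.
    by rewrite comp_zero comp1m compm1 addf0.
  by rewrite comp_zero comp1m compm1 add0.
- have f0 (C : X) : f ∘ (0 : Hom C A) = 0.
    have -> : (0 : Hom C A) = (0 : Hom (top X) A) ∘ (0 : Hom C (top X)).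
      by rewrite comp_zero.
    rewrite compA (ini _ (f ∘ 0) 0); exact: comp_zero.
  split=> // C x y.
  have e : f ∘ (pi0 + pi1) = f ∘ pi0 + f ∘ pi1.
    have [h [_ hu]] := cop A A B f f.
    apply: (eq_trans (y := h)); [symmetry; apply: hu|apply: hu]; split.
      by rewrite -compA comp_add !pi0_pair !pi1_pair addf0 compm1.
      by rewrite -compA comp_add !pi0_pair !pi1_pair add0 compm1.
      by rewrite comp_add -!compA !pi0_pair !pi1_pair compm1 f0 addf0.
      by rewrite comp_add -!compA !pi0_pair !pi1_pair compm1 f0 add0.
  have := f_equal (fun k => k ∘ ⟨x, y⟩) e.
  by rewrite comp_add -!compA comp_add pi0_pair pi1_pair.
Qed.

Record is_differential_combinator (X : CLACat)
    (D : forall A B : X, Hom A B -> Hom (A × A) B) : Prop := {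
  cd1_add : forall (A B : X) (f g : Hom A B), D _ _ (f + g) = D _ _ f + D _ _ g;
  cd1_zero : forall A B : X, D A B 0 = 0;
  cd2_add : forall (A B : X) (f : Hom A B),
    D _ _ f ∘ (idm A ⊠ nabla A) =
    D _ _ f ∘ (idm A ⊠ pi0) + D _ _ f ∘ (idm A ⊠ pi1);
  cd2_zero : forall (A B : X) (f : Hom A B), D _ _ f ∘ iota0 = 0;
  cd3_id : forall A : X, D _ _ (idm A) = pi1;
  cd3_pi0 : forall A B : X, D (A × B) A pi0 = pi0 ∘ pi1;
  cd3_pi1 : forall A B : X, D (A × B) B pi1 = pi1 ∘ pi1;
  cd4 : forall (A B C : X) (f : Hom C A) (g : Hom C B),
    D _ _ ⟨f, g⟩ = ⟨D _ _ f, D _ _ g⟩;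
  cd5 : forall (A B C : X) (g : Hom B C) (f : Hom A B),
    D _ _ (g ∘ f) = D _ _ g ∘ ⟨f ∘ pi0, D _ _ f⟩;
  cd6 : forall (A B : X) (f : Hom A B), D _ _ (D _ _ f) ∘ ell A = D _ _ f;
  cd7 : forall (A B : X) (f : Hom A B),
    D _ _ (D _ _ f) ∘ cflip A = D _ _ (D _ _ f)
}.

Record CDCat := {
  cd_cla :> CLACat;
  cd_D : forall A B : cd_cla, Hom A B -> Hom (A × A) B;
  cd_axioms : is_differential_combinator cd_D
}.
Arguments cd_D c {A B} f.
Notation "'D[' f ]" := (cd_D _ f) (format "'D[' f ]") : cat_scope.

Definition D_linear (X : CDCat) (A B : X) (f : Hom A B) : Prop :=
  D[f] = f ∘ pi1.

(* Equality of arrows of a category, including equality of their (not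
   necessarily convertible) sources and targets. *)
Inductive arrow_eq (X : Category) (A B : X) (f : Hom A B) :
    forall A' B' : X, Hom A' B' -> Prop :=
  arrow_eq_refl : arrow_eq f f.

Record is_CD_iso (X Y : CDCat) (F : Functor X Y) : Prop := {
  cdi_inverse : exists G : Functor Y X, inverse_functors F G;
  cdi_top : F (top X) = top Y;
  cdi_prd : forall A B : X, F (A × B) = F A × F B;
  cdi_pi0 : forall A B : X,
    arrow_eq (fmap F (@pi0 X A B)) (@pi0 Y (F A) (F B));
  cdi_pi1 : forall A B : X,
    arrow_eq (fmap F (@pi1 X A B)) (@pi1 Y (F A) (F B));
  cdi_pair : forall (A B C : X) (f : Hom C A) (g : Hom C B),
    arrow_eq (fmap F ⟨f, g⟩) ⟨fmap F f, fmap F g⟩;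
  cdi_add : forall (A B : X) (f g : Hom A B),
    fmap F (f + g) = fmap F f + fmap F g;
  cdi_zero : forall A B : X,
    fmap F (0 : Hom A B) = (0 : Hom (F A) (F B));
  cdi_D : forall (A B : X) (f : Hom A B), arrow_eq (fmap F D[f]) D[fmap F f]
}.

Section CoKleisli.
Variables (Y : Category) (C : Comonad Y).

Definition ck_hom (A B : Y) : Type := Hom (C A) B.
Definition ck_comp (A1 A2 A3 : Y) (g : ck_hom A2 A3) (f : ck_hom A1 A2) :
  ck_hom A1 A3 := g ∘ fmap C f ∘ delta C A1.

Lemma ck_comp1m (A B : Y) (f : ck_hom A B) : ck_comp (counit C B) f = f.
Proof. by rewrite /ck_comp counit_nat -compA counit_delta compm1. Qed.

Lemma ck_compm1 (A B : Y) (f : ck_hom A B) : ck_comp f (counit C A) = f.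
Proof. by rewrite /ck_comp -compA fmap_counit_delta compm1. Qed.

Lemma ck_compA (A1 A2 A3 A4 : Y)
    (h : ck_hom A3 A4) (g : ck_hom A2 A3) (f : ck_hom A1 A2) :
  ck_comp h (ck_comp g f) = ck_comp (ck_comp h g) f.
Proof.
rewrite /ck_comp !fmap_comp -!compA -delta_delta.
by congr (_ ∘ (_ ∘ _)); rewrite !compA delta_nat.
Qed.

Definition coKleisli : Category :=
  {| Ob := Y; Hom := ck_hom; idm := counit C; comp := ck_comp;
     comp1m := ck_comp1m; compm1 := ck_compm1; compA := ck_compA |}.

(* A map of the coKleisli category viewed in the base category; keeps the two
   composition laws apart, the hom-types being convertible. *)
Definition ck_map {A B : coKleisli} (f : Hom A B) :
  @Hom Y (C A) B := f.
End CoKleisli.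

Notation "⟦ f ⟧" := (ck_map f) (at level 0) : cat_scope.

Section CoKleisliCLA.
Variables (Y : CLACat) (C : Comonad Y).

Local Notation cK := (coKleisli C).

Lemma ck_pi0_pair (A B E : Y) (f : ck_hom C E A) (g : ck_hom C E B) :
  ck_comp (pi0 ∘ counit C (A × B)) (⟨f, g⟩ : ck_hom C E (A × B)) = f.
Proof.
by rewrite /ck_comp -!(compA pi0) counit_nat -!compA counit_delta compm1 pi0_pair.
Qed.

Lemma ck_pi1_pair (A B E : Y) (f : ck_hom C E A) (g : ck_hom C E B) :
  ck_comp (pi1 ∘ counit C (A × B)) (⟨f, g⟩ : ck_hom C E (A × B)) = g.
Proof.
by rewrite /ck_comp -!(compA pi1) counit_nat -!compA counit_delta compm1 pi1_pair.
Qed.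

Lemma ck_lift_comp (A B E : Y) (k : Hom B E) (f : ck_hom C A B) :
  ck_comp (k ∘ counit C B) f = k ∘ f.
Proof. by rewrite /ck_comp -(compA k) counit_nat -!compA counit_delta compm1. Qed.

Lemma ck_comp_lift (A B E : Y) (k : Hom A B) (f : ck_hom C B E) :
  ck_comp f (k ∘ counit C A) = f ∘ fmap C k.
Proof. by rewrite /ck_comp fmap_comp -!compA fmap_counit_delta compm1. Qed.

Lemma ck_pair_uniq (A B E : Y) (h : ck_hom C E (A × B)) :
  h = ⟨ck_comp (pi0 ∘ counit C (A × B)) h,
       ck_comp (pi1 ∘ counit C (A × B)) h⟩.
Proof. by rewrite !ck_lift_comp; apply: pair_ext; rewrite ?pi0_pair ?pi1_pair. Qed.

Definition coKleisli_products : FiniteProducts cK :=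
  {| fp_top := top Y : cK;
     fp_bang := fun A => (0 : Hom (C A) (top Y));
     fp_bang_uniq := fun A (f g : Hom (C A) (top Y)) => top_uniq f g;
     fp_prod := fun A B => A × B;
     fp_pi0 := fun A B => pi0 ∘ counit C (A × B);
     fp_pi1 := fun A B => pi1 ∘ counit C (A × B);
     fp_pair := fun A B E (f : Hom (C E) A) (g : Hom (C E) B) => ⟨f, g⟩;
     fp_pi0_pair := ck_pi0_pair;
     fp_pi1_pair := ck_pi1_pair;
     fp_pair_uniq := ck_pair_uniq |}.

Lemma ck_comp_add (A B E : Y) (f g : ck_hom C B E) (x : ck_hom C A B) :
  ck_comp (f + g : Hom (C B) E) x = (ck_comp f x + ck_comp g x : Hom (C A) E).
Proof. by rewrite /ck_comp !comp_add. Qed.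

Lemma ck_comp_zero (A B E : Y) (x : ck_hom C A B) :
  ck_comp (0 : Hom (C B) E) x = (0 : Hom (C A) E).
Proof. by rewrite /ck_comp !comp_zero. Qed.

Definition coKleisli_add : LeftAdditive cK :=
  {| la_add := fun A B : cK => @add Y (C A) B;
     la_zero := fun A B : cK => @zero Y (C A) B;
     la_addA := fun A B : cK => @addA Y (C A) B;
     la_addC := fun A B : cK => @addC Y (C A) B;
     la_add0 := fun A B : cK => @add0 Y (C A) B;
     la_comp_add := ck_comp_add;
     la_comp_zero := ck_comp_zero |}.

Lemma ck_lift_additive (A B : Y) (k : Hom A B) :
  additive k -> additive_for coKleisli_add (k ∘ counit C A : @Hom cK A B).
Proof.
move=> kadd; split=> [E x y|E]; rewrite /= !ck_lift_comp.
  exact: additive_add.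
exact: additive_zero.
Qed.

Definition coKleisli_CLA : CLACat :=
  {| cla_cat := cK;
     cla_prod := coKleisli_products;
     cla_add := coKleisli_add;
     cla_pi0_additive := fun A B => ck_lift_additive (@pi0_additive Y A B);
     cla_pi1_additive := fun A B => ck_lift_additive (@pi1_additive Y A B) |}.
End CoKleisliCLA.

Record is_differential_combinator_transformation (Y : CLACat) (C : Comonad Y)
    (d : forall A : Y, Hom (C (A × A)) (C A)) : Prop := {
  dc_nat : forall (A B : Y) (f : Hom A B),
    d B ∘ fmap C (f ⊠ f) = fmap C f ∘ d A;
  dc1 : forall A : Y, d A ∘ fmap C iota0 = 0;
  dc2 : forall A : Y,
    d A ∘ fmap C (idm A ⊠ nabla A) =
    d A ∘ (fmap C (idm A ⊠ pi0) + fmap C (idm A ⊠ pi1));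
  dc3 : forall A : Y, counit C A ∘ d A = pi1 ∘ counit C (A × A);
  dc4 : forall A : Y,
    delta C A ∘ d A =
    d (C A) ∘ fmap C ⟨fmap C pi0, d A⟩ ∘ delta C (A × A);
  dc5 : forall A : Y, d A ∘ d (A × A) ∘ fmap C (ell A) = d A;
  dc6 : forall A : Y, d A ∘ d (A × A) ∘ fmap C (cflip A) = d A ∘ d (A × A)
}.

Record is_CD_comonad (Y : CLACat) (C : Comonad Y)
    (d : forall A : Y, Hom (C (A × A)) (C A)) : Prop := {
  cdc_biproducts : has_finite_biproducts Y;
  cdc_transformation : is_differential_combinator_transformation d
}.

Section CoKleisliCD.
Variables (Y : CLACat) (C : Comonad Y).
Variable d : forall A : Y, Hom (C (A × A)) (C A).

Definition coKleisli_D (A B : coKleisli_CLA C) (f : Hom A B) :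
  Hom (A × A) B := ⟦f⟧ ∘ d A.

Hypothesis dP : is_CD_comonad d.
Let bip := cdc_biproducts dP.
Let dct := cdc_transformation dP.

Lemma ck_prod_map_lift (A B A' B' : Y) (h : Hom A A') (k : Hom B B') :
  @prod_map (coKleisli_CLA C) A B A' B' (h ∘ counit C A) (k ∘ counit C B) =
  (h ⊠ k) ∘ counit C (A × B).
Proof.
rewrite /prod_map pair_comp -!compA.
change (@pair (coKleisli_CLA C)) with
  (fun (A B E : Y) (f : Hom (C E) A) (g : Hom (C E) B) => ⟨f, g⟩).
congr (pair _ _).
  change (ck_comp (h ∘ counit C A) (pi0 ∘ counit C (A × B)) =
    h ∘ (pi0 ∘ counit C (A × B))).
  exact: ck_lift_comp.
change (ck_comp (k ∘ counit C B) (pi1 ∘ counit C (A × B)) =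
  k ∘ (pi1 ∘ counit C (A × B))).
exact: ck_lift_comp.
Qed.

Lemma ck_id_prod_map_lift (A B B' : Y) (k : Hom B B') :
  @prod_map (coKleisli_CLA C) A B A B' (counit C A) (k ∘ counit C B) =
  (idm A ⊠ k) ∘ counit C (A × B).
Proof. by rewrite -ck_prod_map_lift comp1m. Qed.

Lemma ck_nabla (A : Y) :
  @nabla (coKleisli_CLA C) A = nabla A ∘ counit C (A × A).
Proof. by rewrite /nabla comp_add. Qed.

Lemma ck_iota0 (A B : Y) :
  @iota0 (coKleisli_CLA C) A B = iota0 ∘ counit C A.
Proof. by rewrite /iota0 pair_comp comp1m comp_zero. Qed.

Lemma ck_iota1 (A B : Y) :
  @iota1 (coKleisli_CLA C) A B = iota1 ∘ counit C B.
Proof. by rewrite /iota1 pair_comp comp1m comp_zero. Qed.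

Lemma ck_ell (A : Y) : @ell (coKleisli_CLA C) A = ell A ∘ counit C (A × A).
Proof. by rewrite /ell ck_iota0 ck_iota1 ck_prod_map_lift. Qed.

Lemma ck_cflip (A : Y) :
  @cflip (coKleisli_CLA C) A = cflip A ∘ counit C ((A × A) × (A × A)).
Proof.
rewrite /cflip pair_comp.
have e0 := ck_prod_map_lift (@pi0 Y A A) (@pi0 Y A A).
have e1 := ck_prod_map_lift (@pi1 Y A A) (@pi1 Y A A).
by rewrite -e0 -e1.
Qed.

(* Objects of the coKleisli category are re-typed as objects of [Y], so that
   the operations below are elaborated in [Y]. *)
Ltac in_base A := change (Ob Y) in (type of A).

Lemma coKleisli_D_axioms : is_differential_combinator coKleisli_D.
Proof.
split.
- move=> A B; in_base A; in_base B.
  move=> f g.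
  exact (@comp_add Y _ _ _ (f : Hom (C A) B) g (d A)).
- move=> A B; in_base A; in_base B.
  exact (@comp_zero Y _ _ B (d A)).
- move=> A B; in_base A; in_base B.
  move=> f; rewrite ck_nabla.
  have e0 := ck_id_prod_map_lift A (@pi0 Y A A).
  have e1 := ck_id_prod_map_lift A (@pi1 Y A A).
  have e2 := ck_id_prod_map_lift A (nabla A).
  change (@idm (coKleisli_CLA C) A) with (counit C A).
  change (@pi0 (coKleisli_CLA C) A A) with (pi0 ∘ counit C (A × A)).
  change (@pi1 (coKleisli_CLA C) A A) with (pi1 ∘ counit C (A × A)).
  rewrite e0 e1 e2.
  change (ck_comp (⟦f⟧ ∘ d A) ((idm A ⊠ nabla A) ∘ counit C (A × (A × A))) =
    ck_comp (⟦f⟧ ∘ d A) ((idm A ⊠ pi0) ∘ counit C (A × (A × A))) +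
    ck_comp (⟦f⟧ ∘ d A) ((idm A ⊠ pi1) ∘ counit C (A × (A × A)))).
  rewrite !ck_comp_lift -compA (dc2 dct) compA additive_add //; exact (bip _ _ _).
- move=> A B; in_base A; in_base B.
  move=> f; rewrite ck_iota0.
  change (ck_comp (⟦f⟧ ∘ d A) (iota0 ∘ counit C A) = (0 : Hom (C A) B)).
  rewrite ck_comp_lift -compA (dc1 dct) additive_zero //; exact (bip _ _ _).
- move=> A; in_base A; exact (dc3 dct A).
- move=> A B; in_base A; in_base B.
  change (pi0 ∘ counit C (A × B) ∘ d (A × B) =
    ck_comp (pi0 ∘ counit C (A × B)) (pi1 ∘ counit C ((A × B) × (A × B)))).
  by rewrite ck_lift_comp -compA (dc3 dct).
- move=> A B; in_base A; in_base B.
  change (pi1 ∘ counit C (A × B) ∘ d (A × B) =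
    ck_comp (pi1 ∘ counit C (A × B)) (pi1 ∘ counit C ((A × B) × (A × B)))).
  by rewrite ck_lift_comp -compA (dc3 dct).
- move=> A B E; in_base A; in_base B; in_base E.
  move=> f g.
  exact (@pair_comp Y _ _ _ _ (f : Hom (C E) A) g (d E)).
- move=> A B E; in_base A; in_base B; in_base E.
  move=> g f.
  change (@Hom Y (C A) B) in (type of f); change (@Hom Y (C B) E) in (type of g).
  change (g ∘ fmap C f ∘ delta C A ∘ d A =
    ck_comp (g ∘ d B) (⟨ck_comp f (pi0 ∘ counit C (A × A)), f ∘ d A⟩
       : ck_hom C (A × A) (B × B))).
  rewrite ck_comp_lift /ck_comp -(compA (g ∘ _)) (dc4 dct).
  have -> : ⟨f ∘ fmap C pi0, f ∘ d A⟩ =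
            (f ⊠ f) ∘ ⟨fmap C pi0, d A⟩.
    by rewrite prod_map_pair.
  rewrite fmap_comp !compA -(compA g (d B)) (dc_nat dct).
  by rewrite !compA.
- move=> A B; in_base A; in_base B.
  move=> f; rewrite ck_ell.
  change (ck_comp (⟦f⟧ ∘ d A ∘ d (A × A)) (ell A ∘ counit C (A × A)) =
    ⟦f⟧ ∘ d A).
  by rewrite ck_comp_lift -!compA compA -!compA (compA (d A)) (dc5 dct).
- move=> A B; in_base A; in_base B.
  move=> f; rewrite ck_cflip.
  change (ck_comp (⟦f⟧ ∘ d A ∘ d (A × A))
     (cflip A ∘ counit C ((A × A) × (A × A))) = ⟦f⟧ ∘ d A ∘ d (A × A)).
  by rewrite ck_comp_lift -!compA (compA (d A)) (dc6 dct).
Qed.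

Definition coKleisli_CD : CDCat :=
  {| cd_cla := coKleisli_CLA C;
     cd_D := coKleisli_D;
     cd_axioms := coKleisli_D_axioms |}.
End CoKleisliCD.

Record AbstractCoKleisli (X : Category) := {
  bang :> Functor X X;
  phi : forall A : X, Hom A (bang A);
  eps : forall A : X, Hom (bang A) A;
  phi_nat : forall (A B : X) (f : Hom A B), phi B ∘ f = fmap bang f ∘ phi A;
  eps_bang_nat : forall (A B : X) (f : Hom A B),
    eps (bang B) ∘ fmap bang (fmap bang f) = fmap bang f ∘ eps (bang A);
  eps_phi : forall A : X, eps A ∘ phi A = idm A;
  eps_bang_phi : forall A : X, eps (bang A) ∘ fmap bang (phi A) = idm (bang A);
  eps_eps : forall A : X, eps A ∘ eps (bang A) = eps A ∘ fmap bang (eps A)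
}.
Arguments phi {X} a A.
Arguments eps {X} a A.

Definition eps_natural (X : Category) (S : AbstractCoKleisli X) (A B : X)
    (f : Hom A B) : Prop :=
  eps S B ∘ fmap S f = f ∘ eps S A.

Section EpsNat.
Variables (X : Category) (S : AbstractCoKleisli X).

Lemma eps_natural_id (A : X) : eps_natural S (idm A).
Proof. by rewrite /eps_natural fmap_id compm1 comp1m. Qed.

Lemma eps_natural_comp (A B C : X) (g : Hom B C) (f : Hom A B) :
  eps_natural S g -> eps_natural S f -> eps_natural S (g ∘ f).
Proof. by rewrite /eps_natural fmap_comp compA => -> e; rewrite -compA e compA. Qed.

Lemma eps_natural_eps (A : X) : eps_natural S (eps S A).
Proof. by rewrite /eps_natural eps_eps. Qed.

Lemma eps_natural_fmap (A B : X) (f : Hom A B) : eps_natural S (fmap S f).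
Proof. exact: eps_bang_nat. Qed.

Definition epsnat_hom (A B : X) : Type := {f : Hom A B | eps_natural S f}.

Lemma epsnat_eq (A B : X) (f g : epsnat_hom A B) :
  proj1_sig f = proj1_sig g -> f = g.
Proof. exact: (eq_sig_hprop (fun _ => proof_irrelevance _)). Qed.

Definition epsnat_id (A : X) : epsnat_hom A A := exist _ _ (eps_natural_id A).
Definition epsnat_comp (A B C : X) (g : epsnat_hom B C) (f : epsnat_hom A B) :
  epsnat_hom A C :=
  exist _ _ (eps_natural_comp (proj2_sig g) (proj2_sig f)).

Lemma epsnat_comp1m (A B : X) (f : epsnat_hom A B) :
  epsnat_comp (epsnat_id B) f = f.
Proof. by apply: epsnat_eq; exact: comp1m. Qed.
Lemma epsnat_compm1 (A B : X) (f : epsnat_hom A B) :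
  epsnat_comp f (epsnat_id A) = f.
Proof. by apply: epsnat_eq; exact: compm1. Qed.
Lemma epsnat_compA (A B C E : X) (h : epsnat_hom C E) (g : epsnat_hom B C)
    (f : epsnat_hom A B) :
  epsnat_comp h (epsnat_comp g f) = epsnat_comp (epsnat_comp h g) f.
Proof. by apply: epsnat_eq; exact: compA. Qed.

Definition epsnat : Category :=
  {| Ob := X; Hom := epsnat_hom; idm := epsnat_id; comp := epsnat_comp;
     comp1m := epsnat_comp1m; compm1 := epsnat_compm1;
     compA := epsnat_compA |}.

Definition epsnat_fmap (A B : X) (f : epsnat_hom A B) :
  epsnat_hom (S A) (S B) := exist _ _ (eps_natural_fmap (proj1_sig f)).

Lemma epsnat_fmap_id (A : X) : epsnat_fmap (epsnat_id A) = epsnat_id (S A).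
Proof. by apply: epsnat_eq; exact: fmap_id. Qed.
Lemma epsnat_fmap_comp (A B C : X) (g : epsnat_hom B C) (f : epsnat_hom A B) :
  epsnat_fmap (epsnat_comp g f) =
  epsnat_comp (epsnat_fmap g) (epsnat_fmap f).
Proof. by apply: epsnat_eq; exact: fmap_comp. Qed.

Definition epsnat_functor : Functor epsnat epsnat :=
  {| fobj := (fun A => S A) : epsnat -> epsnat;
     fmap := epsnat_fmap;
     fmap_id := epsnat_fmap_id;
     fmap_comp := epsnat_fmap_comp |}.

Definition epsnat_beta (A : X) : epsnat_hom (S A) (S (S A)) :=
  exist _ _ (eps_natural_fmap (phi S A)).
Definition epsnat_eps (A : X) : epsnat_hom (S A) A :=
  exist _ _ (eps_natural_eps A).

Lemma epsnat_beta_nat (A B : X) (f : epsnat_hom A B) :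
  epsnat_comp (epsnat_beta B) (epsnat_fmap f) =
  epsnat_comp (epsnat_fmap (epsnat_fmap f)) (epsnat_beta A).
Proof. by apply: epsnat_eq; rewrite /= -!fmap_comp phi_nat. Qed.
Lemma epsnat_eps_nat (A B : X) (f : epsnat_hom A B) :
  epsnat_comp (epsnat_eps B) (epsnat_fmap f) = epsnat_comp f (epsnat_eps A).
Proof. by apply: epsnat_eq; exact: (proj2_sig f). Qed.
Lemma epsnat_eps_beta (A : X) :
  epsnat_comp (epsnat_eps (S A)) (epsnat_beta A) = epsnat_id (S A).
Proof. by apply: epsnat_eq; exact: eps_bang_phi. Qed.
Lemma epsnat_fmap_eps_beta (A : X) :
  epsnat_comp (epsnat_fmap (epsnat_eps A)) (epsnat_beta A) = epsnat_id (S A).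
Proof. by apply: epsnat_eq; rewrite /= -fmap_comp eps_phi fmap_id. Qed.
Lemma epsnat_beta_beta (A : X) :
  epsnat_comp (epsnat_beta (S A)) (epsnat_beta A) =
  epsnat_comp (epsnat_fmap (epsnat_beta A)) (epsnat_beta A).
Proof. by apply: epsnat_eq; rewrite /= -!fmap_comp phi_nat. Qed.

(* The comonad (!, β, ϵ). *)
Definition epsnat_comonad : Comonad epsnat :=
  {| cm_fun := epsnat_functor;
     delta := epsnat_beta;
     counit := epsnat_eps;
     delta_nat := epsnat_beta_nat;
     counit_nat := epsnat_eps_nat;
     counit_delta := epsnat_eps_beta;
     fmap_counit_delta := epsnat_fmap_eps_beta;
     delta_delta := epsnat_beta_beta |}.

Definition G_eps_map (A B : X) (f : Hom A B) : epsnat_hom (S A) B :=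
  exist _ (eps S B ∘ fmap S f)
    (eps_natural_comp (eps_natural_eps B) (eps_natural_fmap f)).

Lemma G_eps_id (A : X) : G_eps_map (idm A) = epsnat_eps A.
Proof. by apply: epsnat_eq; rewrite /= fmap_id compm1. Qed.

Lemma G_eps_comp (A B C : X) (g : Hom B C) (f : Hom A B) :
  G_eps_map (g ∘ f) =
  @comp (coKleisli epsnat_comonad) A B C (G_eps_map g) (G_eps_map f).
Proof.
apply: epsnat_eq; rewrite /= !fmap_comp -!compA; congr (_ ∘ (_ ∘ _)).
by rewrite -fmap_comp -phi_nat fmap_comp compA -fmap_comp eps_phi fmap_id comp1m.
Qed.

Definition G_eps : Functor X (coKleisli epsnat_comonad) :=
  {| fobj := (fun A => A) : X -> coKleisli epsnat_comonad;
     fmap := G_eps_map;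
     fmap_id := G_eps_id;
     fmap_comp := G_eps_comp |}.

Definition G_eps_inv_map (A B : coKleisli epsnat_comonad) (f : Hom A B) :
  @Hom X A B := proj1_sig ⟦f⟧ ∘ phi S A.

Lemma G_eps_inv_id (A : coKleisli epsnat_comonad) :
  G_eps_inv_map (idm A) = @idm X A.
Proof. exact: eps_phi. Qed.

Lemma G_eps_inv_comp (A B C : coKleisli epsnat_comonad)
    (g : Hom B C) (f : Hom A B) :
  G_eps_inv_map (g ∘ f) = (G_eps_inv_map g ∘ G_eps_inv_map f : @Hom X A C).
Proof.
rewrite /G_eps_inv_map /= /ck_map -!compA.
by rewrite (compA (phi S B)) (phi_nat S (proj1_sig f)) -!compA (phi_nat S (phi S A)).
Qed.

Definition G_eps_inv : Functor (coKleisli epsnat_comonad) X :=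
  {| fobj := (fun A => A) : coKleisli epsnat_comonad -> X;
     fmap := G_eps_inv_map;
     fmap_id := G_eps_inv_id;
     fmap_comp := G_eps_inv_comp |}.
End EpsNat.

Record is_CLA_abstract_coKleisli (X : CLACat) (S : AbstractCoKleisli X) :
    Prop := {
  clack_pi0 : forall A B : X, eps_natural S (@pi0 X A B);
  clack_pi1 : forall A B : X, eps_natural S (@pi1 X A B);
  clack_zero : forall A B : X, eps_natural S (0 : Hom A B);
  clack_add : forall (A B : X) (f g : Hom A B),
    eps_natural S f -> eps_natural S g -> eps_natural S (f + g)
}.

Record is_CD_abstract_coKleisli (X : CDCat) (S : AbstractCoKleisli X) :
    Prop := {
  cdack_cla : is_CLA_abstract_coKleisli S;
  cdack_linear : forall (A B : X) (f : Hom A B),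
    eps_natural S f -> D_linear f
}.

Section EpsNatCLA.
Variables (X : CLACat) (S : AbstractCoKleisli X).
Hypothesis SP : is_CLA_abstract_coKleisli S.

Lemma eps_natural_pair (A B C : X) (f : Hom C A) (g : Hom C B) :
  eps_natural S f -> eps_natural S g -> eps_natural S ⟨f, g⟩.
Proof.
rewrite /eps_natural => ef eg.
have e0 := clack_pi0 SP A B; have e1 := clack_pi1 SP A B.
apply: pair_ext; rewrite !compA ?pi0_pair ?pi1_pair.
  by rewrite -e0 -compA -fmap_comp pi0_pair.
by rewrite -e1 -compA -fmap_comp pi1_pair.
Qed.

Local Notation eY := (epsnat S).

Definition epsnat_products : FiniteProducts eY.
Proof.
refine {|
  fp_top := top X : eY;
  fp_bang := fun A => exist _ (fp_bang (cla_prod X) A) (top_uniq _ _);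
  fp_prod := fun A B => @prd X A B;
  fp_pi0 := fun A B => exist _ pi0 (clack_pi0 SP A B);
  fp_pi1 := fun A B => exist _ pi1 (clack_pi1 SP A B);
  fp_pair := fun A B C (f : epsnat_hom S C A) (g : epsnat_hom S C B) =>
    exist _ ⟨proj1_sig f, proj1_sig g⟩
      (eps_natural_pair (proj2_sig f) (proj2_sig g)) |}.
- abstract (move=> A f g; apply: epsnat_eq; exact: top_uniq).
- abstract (move=> A B C f g; apply: epsnat_eq; exact: pi0_pair).
- abstract (move=> A B C f g; apply: epsnat_eq; exact: pi1_pair).
- abstract (move=> A B C h; apply: epsnat_eq; exact: fp_pair_uniq).
Defined.

Definition epsnat_add : LeftAdditive eY.
Proof.
refine {|
  la_add := fun (A B : eY) (f g : epsnat_hom S A B) =>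
    exist _ (proj1_sig f + proj1_sig g)
      (clack_add SP (proj2_sig f) (proj2_sig g));
  la_zero := fun A B : eY => exist _ 0 (clack_zero SP A B) |}.
- abstract (move=> A B f g h; apply: epsnat_eq; exact: addA).
- abstract (move=> A B f g; apply: epsnat_eq; exact: addC).
- abstract (move=> A B f; apply: epsnat_eq; exact: add0).
- abstract (move=> A B C f g x; apply: epsnat_eq; exact: comp_add).
- abstract (move=> A B C x; apply: epsnat_eq; exact: comp_zero).
Defined.

Lemma epsnat_additive (A B : X) (f : epsnat_hom S A B) :
  additive (proj1_sig f) -> additive_for epsnat_add (f : @Hom eY A B).
Proof.
move=> fa; split=> [C x y|C]; apply: epsnat_eq.
  exact: (additive_add _ _ fa).
exact (@additive_zero X A B C _ fa).
Qed.

Definition epsnat_CLA : CLACat :=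
  {| cla_cat := eY;
     cla_prod := epsnat_products;
     cla_add := epsnat_add;
     cla_pi0_additive := fun A B =>
       @epsnat_additive _ _ (fp_pi0 epsnat_products A B) (@pi0_additive X A B);
     cla_pi1_additive := fun A B =>
       @epsnat_additive _ _ (fp_pi1 epsnat_products A B) (@pi1_additive X A B)
  |}.
End EpsNatCLA.

Section EpsNatPartial.
Variables (X : CDCat) (S : AbstractCoKleisli X).

Definition epsnat_partial (A : X) : @Hom (epsnat S) (S (A × A)) (S A) :=
  exist _ (eps S (S A) ∘ fmap S D[phi S A])
    (eps_natural_comp (eps_natural_eps S (S A)) (eps_natural_fmap S D[phi S A])).
End EpsNatPartial.

(* Main.v *)
From Stdlib Require Import ssreflect FunctionalExtensionality ProofIrrelevance.
Require Import Defs.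

Set Implicit Arguments.
Unset Strict Implicit.
Unset Printing Implicit Defensive.

(** An [ϵ]-natural map [h : !A -> B] is recovered from [h ∘ φ_A], because
    [h = h ∘ ϵ ∘ !φ = ϵ ∘ !(h ∘ φ)]; so an equation between [ϵ]-natural maps
    out of [!A] may be tested after precomposition with [φ_A]
    ([eps_natural_phi_inj]).  Under this test the comonad disappears: by
    naturality [!f ∘ φ = φ ∘ f], and [∂_A] becomes [D[φ_A]] ([epsnat_partial_phi]).

    The other ingredient is that [ϵ]-natural maps are [D]-linear.  Linear maps
    are additive, so the [ϵ]-natural subcategory has biproducts, and by the
    chain rule they commute with [D] ([D_linear_comp]).  Together these give
    [h ∘ ∂_A ∘ φ = h ∘ D[φ_A] = D[h ∘ φ_A]] for every [ϵ]-natural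
    [h : !A -> B] ([partial_comp_phi]).  This single formula turns the axioms of
    a differential combinator transformation into axioms of [D] applied to [φ]:
    naturality and the compatibility with [δ = !φ] into the chain rule, the
    compatibility with [ϵ] into [D[1] = pi1], and the others into additivity in
    the vector argument, linearity in it and symmetry of second derivatives.
    Read at [h = ϵ ∘ !f], it says that [G_ϵ] preserves [D]: both sides restrict
    along [φ] to [D[f]]. *)

(** * Linear maps *)

Section Linear.
Context {X : CDCat}.
Implicit Types A B C : X.

(** The chain rule, with [D[f] = f ∘ pi1] discarding the base point. *)
Lemma D_linear_comp A B C (f : Hom B C) (x : Hom A B) :
  D_linear f -> D[f ∘ x] = f ∘ D[x].
Proof. by move=> fl; rewrite (cd5 (cd_axioms X)) fl -compA pi1_pair. Qed.

(** A derivative is additive in its vector argument, and the derivative of a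
    linear map is that map itself in the vector argument. *)
Lemma D_linear_additive A B (f : Hom A B) : D_linear f -> additive f.
Proof.
move=> fl; split=> [C x y|C].
  have := f_equal (fun k => k ∘ ⟨0, ⟨x, y⟩⟩) (cd2_add (cd_axioms X) f).
  rewrite fl comp_add -!compA !prod_map_pair !pi1_pair pi0_pair.
  by rewrite /nabla comp_add pi0_pair pi1_pair.
have f0 : f ∘ (0 : Hom A A) = 0.
  by rewrite -(cd2_zero (cd_axioms X) f) fl -compA pi1_pair.
have -> : la_zero (cla_add X) C A = (0 : Hom A A) ∘ (0 : Hom C A).
  by rewrite comp_zero.
rewrite compA f0; exact: comp_zero.
Qed.

End Linear.

(** * Maps out of [!A] *)

Lemma eps_natural_phi_inj (X : Category) (S : AbstractCoKleisli X) (A B : X)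
    (g h : Hom (S A) B) :
  eps_natural S g -> eps_natural S h -> g ∘ phi S A = h ∘ phi S A -> g = h.
Proof.
move=> gn hn e.
by rewrite -(compm1 g) -(compm1 h) -eps_bang_phi !compA -gn -hn -!compA
           -!fmap_comp e.
Qed.

Lemma epsnat_phi_inj (X : Category) (S : AbstractCoKleisli X) (A B : X)
    (g h : epsnat_hom S (S A) B) :
  proj1_sig g ∘ phi S A = proj1_sig h ∘ phi S A -> g = h.
Proof.
move=> e; apply: epsnat_eq.
exact: (eps_natural_phi_inj (proj2_sig g) (proj2_sig h)).
Qed.

Lemma G_eps_map_phi (X : Category) (S : AbstractCoKleisli X) (A B : X)
    (f : Hom A B) : proj1_sig (G_eps_map S f) ∘ phi S A = f.
Proof. by rewrite /= -compA -phi_nat compA eps_phi comp1m. Qed.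

(** * The differential combinator transformation *)

Section Partial.
Variables (X : CDCat) (S : AbstractCoKleisli X).
Hypothesis HS : is_CD_abstract_coKleisli S.
Implicit Types A B C : X.

(** The condition [partial_phi] determines [∂] by [eps_natural_phi_inj], and
    is all that the proofs use of its definition. *)
Variable partial : forall A, epsnat_hom S (S (A × A)) (S A).
Local Notation d A := (proj1_sig (partial A)).
Hypothesis partial_phi : forall A, d A ∘ phi S (A × A) = D[phi S A].

(** By linearity of [h], the derivative [D[h ∘ φ_A]] is [h ∘ D[φ_A]].  As every
    map out of [A] has the form [h ∘ φ_A], this computes all derivatives. *)
Lemma partial_comp_phi A B (h : Hom (S A) B) :
  eps_natural S h -> h ∘ (d A ∘ phi S (A × A)) = D[h ∘ phi S A].
Proof.
by move=> hn; rewrite partial_phi (D_linear_comp _ (cdack_linear HS hn)).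
Qed.

Lemma partial_fmap_phi A B (f : Hom B (A × A)) :
  d A ∘ (fmap S f ∘ phi S B) = D[phi S A] ∘ f.
Proof. by rewrite -phi_nat compA partial_phi. Qed.

Lemma partial_partial_phi A :
  d A ∘ (d (A × A) ∘ phi S ((A × A) × (A × A))) = D[D[phi S A]].
Proof.
by rewrite (partial_comp_phi (proj2_sig (partial A))) partial_phi.
Qed.

Lemma epsnat_biproducts : has_finite_biproducts (epsnat_CLA (cdack_cla HS)).
Proof.
move=> A B f; apply: (@epsnat_additive X S (cdack_cla HS) A B f).
exact: D_linear_additive (cdack_linear HS (proj2_sig f)).
Qed.

Lemma epsnat_partial_transformation :
  @is_differential_combinator_transformation
    (epsnat_CLA (cdack_cla HS)) (epsnat_comonad S) partial.
Proof.
have dn A : eps_natural S (d A) by exact: (proj2_sig (partial A)).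
split.
- move=> A B f; apply: epsnat_phi_inj.
  change (d B ∘ fmap S (@prod_map X A A B B (proj1_sig f) (proj1_sig f))
            ∘ phi S (@prd X A A) =
          fmap S (proj1_sig f) ∘ d A ∘ phi S (@prd X A A)).
  rewrite -!compA partial_fmap_phi partial_comp_phi; first exact: eps_natural_fmap.
  rewrite -phi_nat (cd5 (cd_axioms X)).
  by rewrite (cdack_linear HS (proj2_sig f)).
- move=> A; apply: epsnat_phi_inj.
  change (d A ∘ fmap S (@iota0 X A A) ∘ phi S A = 0 ∘ phi S A).
  by rewrite -compA partial_fmap_phi (cd2_zero (cd_axioms X)) comp_zero.
- move=> A; apply: epsnat_phi_inj.
  change (d A ∘ fmap S (@idm X A ⊠ @nabla X A) ∘ phi S _ =
    d A ∘ (fmap S (@idm X A ⊠ @pi0 X A A) + fmap S (@idm X A ⊠ @pi1 X A A))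
      ∘ phi S _).
  rewrite (additive_add _ _ (D_linear_additive (cdack_linear HS (dn A)))).
  rewrite comp_add -!compA !partial_fmap_phi; exact: (cd2_add (cd_axioms X)).
- move=> A; apply: epsnat_phi_inj.
  change (eps S A ∘ d A ∘ phi S _ = @pi1 X A A ∘ eps S _ ∘ phi S _).
  rewrite -!compA partial_comp_phi; first exact: eps_natural_eps.
  by rewrite !eps_phi (cd3_id (cd_axioms X)) compm1.
- move=> A; apply: epsnat_phi_inj.
  change (fmap S (phi S A) ∘ d A ∘ phi S _ =
    d (S A) ∘ fmap S (@pair X _ _ _ (fmap S (@pi0 X A A)) (d A))
      ∘ fmap S (phi S _) ∘ phi S _).
  rewrite -!compA partial_comp_phi; first exact: eps_natural_fmap.
  rewrite -!phi_nat (compA (fmap S _)) -phi_nat -(compA (phi S _)).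
  rewrite pair_comp -phi_nat (compA (d _)) !partial_phi.
  exact: (cd5 (cd_axioms X)).
- move=> A; apply: epsnat_phi_inj.
  change (d A ∘ d (@prd X A A) ∘ fmap S (@ell X A) ∘ phi S _ = d A ∘ phi S _).
  rewrite -!compA -phi_nat (compA (d (@prd X A A))) (compA (d A)).
  by rewrite partial_partial_phi partial_phi (cd6 (cd_axioms X)).
- move=> A; apply: epsnat_phi_inj.
  change (d A ∘ d (@prd X A A) ∘ fmap S (@cflip X A) ∘ phi S _ =
          d A ∘ d (@prd X A A) ∘ phi S _).
  rewrite -!compA -phi_nat (compA (d (@prd X A A))) (compA (d A)).
  by rewrite partial_partial_phi (cd7 (cd_axioms X)).
Qed.

Lemma epsnat_CD_comonad :
  @is_CD_comonad (epsnat_CLA (cdack_cla HS)) (epsnat_comonad S) partial.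
Proof. split; [exact: epsnat_biproducts | exact: epsnat_partial_transformation]. Qed.

Lemma G_eps_map_D A B (f : Hom A B) :
  G_eps_map S D[f] = epsnat_comp (G_eps_map S f) (partial A).
Proof.
apply: epsnat_phi_inj; rewrite G_eps_map_phi.
change (D[f] = proj1_sig (G_eps_map S f) ∘ d A ∘ phi S (A × A)).
have := partial_comp_phi (proj2_sig (G_eps_map S f)).
by rewrite G_eps_map_phi compA => ->.
Qed.

End Partial.

Lemma epsnat_partial_phi (X : CDCat) (S : AbstractCoKleisli X) (A : X) :
  proj1_sig (epsnat_partial S A) ∘ phi S (A × A) = D[phi S A].
Proof. exact: (G_eps_map_phi S D[phi S A]). Qed.

(** * The isomorphism with the coKleisli category *)

(** Functors sharing their action on objects definitionally can be compared
    without transport along an equality of hom-types. *)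
Lemma functor_eq (X Y : Category) (o : X -> Y)
    (m m' : forall A B : X, Hom A B -> Hom (o A) (o B)) i c i' c' :
  (forall A B f, m A B f = m' A B f) ->
  Build_Functor (fobj := o) (fmap := m) i c =
  Build_Functor (fobj := o) (fmap := m') i' c'.
Proof.
move=> e; have em : m = m'.
  apply: functional_extensionality_dep => A.
  apply: functional_extensionality_dep => B.
  by apply: functional_extensionality => f.
by case: m' / em i' c' {e} => i' c'; congr Build_Functor; exact: proof_irrelevance.
Qed.

Lemma G_eps_inverse (X : Category) (S : AbstractCoKleisli X) :
  inverse_functors (G_eps S) (G_eps_inv S).
Proof.
split; apply: functor_eq => A B f; first exact: G_eps_map_phi.
by apply: epsnat_phi_inj; rewrite /fmap /= -compA -phi_nat compA eps_phi comp1m.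
Qed.

Lemma eq_arrow_eq (X : Category) (A B : X) (f g : Hom A B) :
  f = g -> arrow_eq f g.
Proof. by move->. Qed.

Theorem proposition4p10 (X : CDCat) (S : AbstractCoKleisli X)
    (HS : is_CD_abstract_coKleisli S) :
  let Y : CLACat := epsnat_CLA (cdack_cla HS) in
  let C : Comonad Y := epsnat_comonad S in
  let partial : forall A : Y, Hom (C (A × A)) (C A) := epsnat_partial S in
  has_finite_biproducts Y /\
  exists HD : is_CD_comonad partial,
    let K : CDCat := coKleisli_CD HD in
    let G : Functor X K := G_eps S in
    let Ginv : Functor K X := G_eps_inv S in
    is_CD_iso G /\
    inverse_functors G Ginv /\
    (forall (A B : X) (f : Hom A B),
       ⟦fmap G D[f]⟧ = ⟦D[fmap G f]⟧) /\
    (forall (A B : K) (f : Hom A B),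
       fmap Ginv D[f] = D[fmap Ginv f]).
Proof.
move=> Y C partial; split; first exact: epsnat_biproducts.
have pP := epsnat_partial_phi S.
exists (epsnat_CD_comonad HS pP) => K G Ginv.
have GinvP : inverse_functors G Ginv by exact: G_eps_inverse.
split; [split | split; [exact: GinvP | split]] => //.
- by exists Ginv.
- move=> A B; apply: (@eq_arrow_eq K (@prd X A B) A); apply: epsnat_eq.
  exact: (clack_pi0 (cdack_cla HS)).
- move=> A B; apply: (@eq_arrow_eq K (@prd X A B) B); apply: epsnat_eq.
  exact: (clack_pi1 (cdack_cla HS)).
- move=> A B E f g; apply: (@eq_arrow_eq K E (@prd X A B)).
  apply: (@epsnat_phi_inj X S E (@prd X A B)).
  rewrite (G_eps_map_phi S (pair f g)).
  change (pair f g = pair (proj1_sig (G_eps_map S f)) (proj1_sig (G_eps_map S g))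
                       ∘ phi S E).
  by rewrite pair_comp !G_eps_map_phi.
- move=> A B f g; apply: (@epsnat_phi_inj X S A B).
  rewrite (G_eps_map_phi S (f + g)).
  change (f + g = (proj1_sig (G_eps_map S f) + proj1_sig (G_eps_map S g)) ∘ phi S A).
  by rewrite comp_add !G_eps_map_phi.
- move=> A B; apply: (@epsnat_phi_inj X S A B).
  rewrite (G_eps_map_phi S (0 : Hom A B)).
  by change ((0 : Hom A B) = 0 ∘ phi S A); rewrite comp_zero.
- move=> A B f; apply: (@eq_arrow_eq K (@prd X A A) B); exact: (G_eps_map_D HS pP f).
- exact: (G_eps_map_D HS pP).
- move=> A B f.
  change (proj1_sig ⟦f⟧ ∘ proj1_sig (epsnat_partial S A) ∘ phi S (@prd X A A) =
          D[proj1_sig ⟦f⟧ ∘ phi S A]).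
  have <- := partial_comp_phi HS pP (proj2_sig f); symmetry; exact: compA.
Qed.
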